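(* Let $(R,\mathfrak m)$ be a Gorenstein local ring, and let $\mathfrak a$ and $\mathfrak b$ be two linked ideals of $R$ with $\dim(R/\mathfrak a)=2$. If $R/\mathfrak a$ is not Cohen-Macaulay, then $\operatorname{depth}(R/\mathfrak b)=\operatorname{depth}(R/\mathfrak a)=1$.
   Context: All rings are commutative and Noetherian. Linkage (in a Gorenstein local ring $R$): an ideal $\mathfrak c$ is a Gorenstein ideal if $R/\mathfrak c$ is a Gorenstein ring. Two proper ideals $\mathfrak a,\mathfrak b$ of $R$ are linked if there is a Gorenstein ideal $\mathfrak c$ with $\mathfrak a=\mathfrak c:\mathfrak b$ and $\mathfrak b=\mathfrak c:\mathfrak a$. *)

(* Defs.v *)
From HB Require Import structures.
From mathcomp Require Import all_boot all_order all_algebra.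

Set Implicit Arguments.
Unset Strict Implicit.
Unset Printing Implicit Defensive.

Import GRing.Theory.
Local Open Scope ring_scope.

(* [idealr A] is the library's type of PROPER ideals of [A], and [prime_idealr A]
   its type of prime ideals.  They are boolean predicates; with the classical
   axioms of mathcomp.classical.boolp, every proper ideal is of this form.
   [{ideal_quot I}] is the quotient ring A / I. *)

Section Rings.

Variable A : comNzRingType.

(* x lies in the ideal generated by the entries of s *)
Definition in_span (s : seq A) (x : A) : Prop :=
  exists c : 'I_(size s) -> A, x = \sum_(i < size s) c i * s`_i.

(* The improper ideal, generated by 1, need not be mentioned. *)
Definition noetherian : Prop :=
  forall I : idealr A, exists s : seq A, forall x, x \in I <-> in_span s x.

Definition maximal_ideal (m : idealr A) : Prop :=
  forall J : idealr A, {subset m <= J} -> J =i m.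

Definition local_with (m : idealr A) : Prop :=
  maximal_ideal m /\ forall n : idealr A, maximal_ideal n -> n =i m.

Definition prime_chain (n : nat) : Prop :=
  exists P : 'I_n.+1 -> prime_idealr A,
    forall i j : 'I_n.+1, (i < j)%N ->
      {subset P i <= P j} /\ ~ {subset P j <= P i}.

Definition has_krull_dim (n : nat) : Prop :=
  prime_chain n /\ forall k, prime_chain k -> (k <= n)%N.

(* s_i is a nonzerodivisor on A / (s_0, ..., s_{i-1}) for every i, and
   A / (s) is nonzero. *)
Definition regular_seq (s : seq A) : Prop :=
  (forall i, (i < size s)%N -> forall y,
     in_span (take i s) (s`_i * y) -> in_span (take i s) y)
  /\ ~ in_span s 1.

(* Depth of a local ring: the largest length of a regular sequence contained
   in the maximal ideal. *)
Definition has_depth (n : nat) : Prop :=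
  exists m : idealr A,
    [/\ local_with m,
        exists s : seq A, [/\ {subset s <= m}, regular_seq s & size s = n]
      & forall s : seq A, {subset s <= m} -> regular_seq s -> (size s <= n)%N].

(* For local rings, as [has_depth] entails locality. *)
Definition cohen_macaulay : Prop :=
  noetherian /\ exists n, has_depth n /\ has_krull_dim n.

Definition injective_module (E : lmodType A) : Prop :=
  forall (M N : lmodType A) (f : {linear M -> N}) (g : {linear M -> E}),
    injective f -> exists h : {linear N -> E}, forall x, h (f x) = g x.

(* 0 -> M -> E_0 -> E_1 -> ... is an injective resolution with E_i = 0 for
   i > n. *)
Definition injdim_le (M : lmodType A) (n : nat) : Prop :=
  exists (E : nat -> lmodType A) (e : {linear M -> E 0%N})
         (d : forall i, {linear E i -> E i.+1}),
    [/\ forall i, injective_module (E i),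
        injective e,
        forall x, d 0%N x = 0 <-> exists y, e y = x,
        forall i x, d i.+1 x = 0 <-> exists y, d i y = x
      & forall i, (n < i)%N -> forall x : E i, x = 0].

Definition gorenstein_local : Prop :=
  [/\ noetherian, exists m : idealr A, local_with m
    & exists n, injdim_le (A^o : lmodType A) n].

End Rings.

Section Linkage.

Variable R : comNzRingType.

(* Used only for R local: then R / c is local, so it is a Gorenstein ring
   exactly when it is a Gorenstein local ring. *)
Definition gorenstein_ideal (c : idealr R) : Prop :=
  gorenstein_local {ideal_quot c}.

(* a = c : b *)
Definition is_colon (a c b : idealr R) : Prop :=
  forall x, x \in a <-> (forall y, y \in b -> x * y \in c).

(* Taking c proper loses nothing: c = R would give a = c : b = R. *)
Definition linked (a b : idealr R) : Prop :=
  exists c : idealr R,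
    [/\ gorenstein_ideal c, is_colon a c b & is_colon b c a].

End Linkage.

(* Main.v *)
(* Write S = R / c, a Gorenstein local ring, so that a / c and b / c are the
   annihilators of each other in S.  Ext^j(R / I, S) is computed from the given
   injective resolution E of S as cocycles modulo boundaries in the I-torsion of
   E, with the long exact sequences of
     0 -> R / (I : z) -> R / I -> R / (I + z) -> 0.
   By Bass's argument Ext^j(R / I, S) = 0 for all I and all j > depth S.
   If depth S <= 1, with x a maximal regular sequence on S (x = 0 in depth 0),
   S / x has the double annihilator property, hence descending chains of ideals
   stabilize there and the proof of Krull's principal ideal theorem forbids
   P0 < P1 < P2; if depth S >= 3, there is a chain of four primes over a, as a
   annihilates a nonzero element of S.  Since dim R / a = 2, S has a maximal
   regular sequence x, y of length 2.  Now x is regular on R / a and R / b.  If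
   R / b has a regular sequence of length 2, then Ext^1(R / b, S) = 0, which gives
   (x : b) = a + x, so that y is regular on R / (a + x): then R / a has depth 2
   and is Cohen-Macaulay. *)

Require Import Defs.
From HB Require Import structures.
From Stdlib Require List.
From mathcomp Require Import all_boot all_order all_algebra.
From mathcomp Require Import boolp ring zify.

Set Implicit Arguments.
Unset Strict Implicit.
Unset Printing Implicit Defensive.

(** * Ideals of a Noetherian ring *)

Section Ideals.

Import GRing.Theory.
Local Open Scope ring_scope.

Variable R : comNzRingType.
Implicit Types (I J K P Q : R -> Prop) (r x y z : R).

Definition sub I J := forall x, I x -> J x.

(** Unlike [idealr], this admits the unit ideal, which colons and sums of proper ideals may
    produce. *)
Definition ideal I :=
  [/\ I 0, forall x y, I x -> I y -> I (x + y) & forall r x, I x -> I (r * x)].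

Definition prime_pred P :=
  [/\ ideal P, ~ P 1 & forall x y, P (x * y) -> P x \/ P y].

Definition adjoin I z r := exists i d, I i /\ r = i + d * z.

Definition colon I z r := I (r * z).

Definition strict_sub I J := sub I J /\ ~ sub J I.

Definition prime_chain_over I n :=
  exists P : nat -> R -> Prop,
    (forall i, (i <= n)%N -> prime_pred (P i) /\ sub I (P i)) /\
    (forall i, (i < n)%N -> strict_sub (P i) (P i.+1)).

Definition regular_mod I x := forall r, I (x * r) -> I r.

(** The nonvanishing of the last quotient is left out; it holds for sequences in the maximal
    ideal. *)
Fixpoint regular_over I (s : seq R) : Prop :=
  if s is x :: t then regular_mod I x /\ regular_over (adjoin I x) t else True.

Lemma idealD I x y : ideal I -> I x -> I y -> I (x + y).
Proof. by case=> _ + _; apply. Qed.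

Lemma ideal_mull I r x : ideal I -> I x -> I (r * x).
Proof. by case=> _ _; apply. Qed.

Lemma ideal_mulr I r x : ideal I -> I x -> I (x * r).
Proof. by rewrite mulrC; exact: ideal_mull. Qed.

Lemma idealB I x y : ideal I -> I x -> I y -> I (x - y).
Proof.
by move=> hI hx hy; apply: idealD => //; rewrite -mulN1r; exact: ideal_mull.
Qed.

Lemma idealBr I x y : ideal I -> I y -> I (x - y) -> I x.
Proof. by move=> hI hy hxy; rewrite -(subrK y x); exact: idealD. Qed.

Lemma ideal_idealr (I : idealr R) : ideal (fun x => x \in I).
Proof.
split=> [|x y hx hy|r x hx]; [exact: rpred0 | exact: rpredD | exact: idealMr].
Qed.

Lemma ideal_adjoin I z : ideal I -> ideal (adjoin I z).
Proof.
move=> hI; split.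
- by exists 0, 0; split; [case: hI | ring].
- move=> _ _ [i [d [hi ->]]] [i' [d' [hi' ->]]].
  by exists (i + i'), (d + d'); split; [exact: idealD | ring].
- move=> r _ [i [d [hi ->]]].
  by exists (r * i), (r * d); split; [exact: ideal_mull | ring].
Qed.

Lemma ideal_colon I z : ideal I -> ideal (colon I z).
Proof.
move=> hI; split; rewrite /colon.
- by rewrite mul0r; case: hI.
- by move=> x y hx hy; rewrite mulrDl; exact: idealD.
- by move=> r x hx; rewrite -mulrA; exact: ideal_mull.
Qed.

Lemma sub_adjoin I z : sub I (adjoin I z).
Proof. by move=> x hx; exists x, 0; split=> //; ring. Qed.

Lemma adjoin_mem I z : ideal I -> adjoin I z z.
Proof. by case=> I0 _ _; exists 0, 1; split=> //; ring. Qed.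

Lemma adjoin_sub I J z : ideal J -> sub I J -> J z -> sub (adjoin I z) J.
Proof.
move=> hJ IJ Jz _ [i [d [/IJ hi ->]]].
by apply: idealD => //; exact: ideal_mull.
Qed.

Lemma sub_colon I z : ideal I -> sub I (colon I z).
Proof. by move=> hI x hx; exact: ideal_mulr. Qed.

Lemma sub_antisym I J : sub I J -> sub J I -> I = J.
Proof. by move=> IJ JI; apply/predeqP => x; split=> [/IJ|/JI]. Qed.

Lemma idealr_closed_asbool I :
  ideal I -> ~ I 1 -> idealr_closed (fun x => `[< I x >]).
Proof.
move=> hI nI1; split; first by apply/asboolP; case: hI.
  by apply/negP => /asboolP.
move=> a u v /asboolP hu /asboolP hv; apply/asboolP.
by apply: idealD => //; exact: ideal_mull.
Qed.

Lemma idealr_of_ideal I :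
  ideal I -> ~ I 1 -> exists J : idealr R, forall x, (x \in J) <-> I x.
Proof.
move=> hI nI1; pose B : R -> bool := fun x => `[< I x >].
pose BI := isIdealr.Build R B (idealr_closed_asbool hI nI1).
pose J : idealr R := HB.pack B BI.
by exists J => x; split=> [/asboolP|hx] //; exact/asboolP.
Qed.

Lemma prime_idealr_of_prime P :
  prime_pred P -> exists J : prime_idealr R, forall x, (x \in J) <-> P x.
Proof.
case=> hP nP1 pP; pose B : R -> bool := fun x => `[< P x >].
pose BI := isIdealr.Build R B (idealr_closed_asbool hP nP1).
have pB : prime_idealr_closed B.
  move=> u v /asboolP /pP h; apply/orP.
  by case: h => h; [left | right]; exact/asboolP.
pose BP := isPrimeIdealrClosed.Build R B pB.
pose J : prime_idealr R := HB.pack B BI BP.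
by exists J => x; split=> [/asboolP|hx] //; exact/asboolP.
Qed.

Lemma in_span_nil x : in_span [::] x <-> x = 0.
Proof.
split=> [[c ->]|->]; first by rewrite big_ord0.
by exists (fun _ => 0); rewrite big_ord0.
Qed.

Lemma in_span_cons z s x :
  in_span (z :: s) x <-> exists d y, in_span s y /\ x = d * z + y.
Proof.
split=> [[c ->]|[d [y [[c ->] ->]]]].
  rewrite big_ord_recl; exists (c ord0), (\sum_(i < size s) c (lift ord0 i) * s`_i).
  by split=> //; exists (fun i => c (lift ord0 i)).
exists (fun i => if unlift ord0 i is Some j then c j else d).
rewrite big_ord_recl /= unlift_none; congr (_ + _).
by apply: eq_bigr => i _; rewrite liftK.
Qed.

Lemma ideal_in_span I s x :
  ideal I -> (forall i, (i < size s)%N -> I s`_i) -> in_span s x -> I x.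
Proof.
move=> hI hs [c ->]; apply: (big_ind I) => [|y z hy hz|i _].
- by case: hI.
- exact: idealD.
- by apply: ideal_mull => //; exact: hs.
Qed.

Lemma foldl_adjoinP I s x :
  foldl adjoin I s x <-> exists i y, [/\ I i, in_span s y & x = i + y].
Proof.
elim: s I x => [|z s IHs] I x /=.
  split=> [hx|[i [y [hi /in_span_nil -> ->]]]]; last by rewrite addr0.
  by exists x, 0; split=> //; [exact/in_span_nil | ring].
split=> [/IHs [_ [y [[i [d [hi ->]]] hy ->]]]|].
  exists i, (d * z + y); split=> //; last by ring.
  by apply/in_span_cons; exists d, y.
move=> [i [_ [hi /in_span_cons [d [y [hy ->]]] ->]]].
apply/IHs; exists (i + d * z), y; split=> //; last by ring.
by exists i, d.
Qed.

(** * Ascending chains, associated primes and prime avoidance *)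

Section Noetherian.

Hypothesis noethR : noetherian R.

Lemma ideal_fin_gen I :
  ideal I -> exists s : seq R, forall x, I x <-> in_span s x.
Proof.
move=> hI; case: (pselect (I 1)) => [I1|nI1].
  exists [:: 1] => x; split=> _; last first.
    by rewrite -(mulr1 x); exact: ideal_mull.
  by apply/in_span_cons; exists x, 0; split; [exact/in_span_nil | ring].
have [J hJ] := idealr_of_ideal hI nI1; have [s hs] := noethR J.
by exists s => x; rewrite -hJ.
Qed.

(** A finitely generated [I] arises from [c] by adjoining its generators one at a time. *)
Lemma ideal_adjoin_ind (G : (R -> Prop) -> Prop) c :
    ideal c -> G c ->
    (forall I z, ideal I -> sub c I -> G I -> G (adjoin I z)) ->
  forall I, ideal I -> sub c I -> G I.
Proof.
move=> hc Gc step I hI cI; have [s hs] := ideal_fin_gen hI.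
have -> : I = foldl adjoin c s.
  apply: sub_antisym => r.
    move=> /hs hr; apply/foldl_adjoinP; exists 0, r.
    by split=> //; [case: hc | rewrite add0r].
  move=> /foldl_adjoinP [i [y [/cI Ii /hs Iy ->]]]; exact: idealD.
have : forall J, ideal J -> sub c J -> G J -> G (foldl adjoin J s).
  elim: (s) => [|z t IHt] J hJ cJ GJ //=; apply: IHt.
  - exact: ideal_adjoin.
  - by move=> x /cJ; exact: sub_adjoin.
  - exact: step.
by apply.
Qed.

(** The union of the chain is an ideal, and its finitely many generators all lie in one [I N]. *)
Lemma ideal_acc (I : nat -> R -> Prop) :
    (forall n, ideal (I n)) -> (forall n, sub (I n) (I n.+1)) ->
  exists N, forall n, sub (I n) (I N).
Proof.
move=> hI Iinc.
have Imon k n : sub (I n) (I (n + k)%N).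
  elim: k => [|k IHk] x hx; first by rewrite addn0.
  by rewrite addnS; apply: Iinc; exact: IHk.
have Ile n p : (n <= p)%N -> sub (I n) (I p).
  by move=> le_np; rewrite -(subnKC le_np); exact: Imon.
have hU : ideal (fun x => exists n, I n x).
  split; first by exists 0%N; case: (hI 0%N).
    move=> x y [n hx] [p hy]; exists (maxn n p).
    by apply: idealD => //; [apply: (Ile n)|apply: (Ile p)];
      rewrite ?leq_maxl ?leq_maxr.
  by move=> r x [n hx]; exists n; exact: ideal_mull.
have [s hs] := ideal_fin_gen hU.
have [N hN] : exists N, forall i, (i < size s)%N -> I N s`_i.
  have : forall i, (i < size s)%N -> exists n, I n s`_i.
    move=> i lt_i; apply/hs; exists (fun j => (j == Ordinal lt_i)%:R).
    rewrite (bigD1 (Ordinal lt_i)) //= eqxx mul1r big1 ?addr0 // => j.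
    by move=> /negPf ->; rewrite mul0r.
  elim: (s) => [|z t IHt] ht; first by exists 0%N.
  have [|N hN] := IHt; first by move=> i; exact: (ht i.+1).
  have [p hp] := ht 0%N isT.
  exists (maxn p N) => -[|i] lt_i; first exact: (Ile _ _ (leq_maxl _ _)).
  by apply: (Ile _ _ (leq_maxr _ _)); exact: hN.
by exists N => n x hx; apply: (ideal_in_span (hI N) hN); apply/hs; exists n.
Qed.

Lemma noetherian_ind (G : (R -> Prop) -> Prop) :
    (forall I, ideal I ->
       (forall J, ideal J -> sub I J -> ~ sub J I -> G J) -> G I) ->
  forall I, ideal I -> G I.
Proof.
move=> step I0 hI0; apply: contrapT => nG0.
pose T := {I : R -> Prop | ideal I /\ ~ G I}.
have next (t : T) : exists t' : T, sub (sval t) (sval t') /\ ~ sub (sval t') (sval t).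
  case: t => I [hI nG] /=; apply: contrapT => none; apply: nG.
  apply: step => // J hJ IJ nJI; apply: contrapT => nGJ.
  by apply: none; exists (exist _ J (conj hJ nGJ)).
have [g hg] := choice next.
pose F n := sval (iter n g (exist _ I0 (conj hI0 nG0))).
have hF n : ideal (F n) by rewrite /F; case: (iter _ _ _) => ? [].
have [N hN] := @ideal_acc F hF (fun n => (hg _).1).
by apply: (hg (iter N g (exist _ I0 (conj hI0 nG0)))).2; exact: (hN N.+1).
Qed.

Lemma exists_maximal (G : (R -> Prop) -> Prop) I0 :
    ideal I0 -> G I0 ->
  exists I, [/\ ideal I, G I, sub I0 I
    & forall J, ideal J -> G J -> sub I J -> sub J I].
Proof.
move=> hI0; pattern I0; move: I0 hI0; apply: noetherian_ind => I hI IH GI.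
case: (pselect (exists J, [/\ ideal J, G J, sub I J & ~ sub J I])).
  move=> [J [hJ GJ IJ nJI]]; have [K [hK GK JK maxK]] := IH J hJ IJ nJI GJ.
  by exists K; split=> // x /IJ /JK.
move=> none; exists I; split=> // J hJ GJ IJ.
by apply: contrapT => nJI; apply: none; exists J.
Qed.

(* Ideals maximal among those missing the multiplicative set of all [u ^+ n * s]
   with [s] outside [P] are prime. *)
Lemma prime_avoiding_regular I u P :
    ideal I -> regular_mod I u -> prime_pred P -> sub I P ->
  exists Q, [/\ prime_pred Q, sub I Q, sub Q P & ~ Q u].
Proof.
move=> hI reg_u [hP nP1 pP] IP.
pose G J := forall n s, J (u ^+ n * s) -> P s.
have GI : G I.
  elim=> [|n IHn] s; first by rewrite expr0 mul1r; exact: IP.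
  by rewrite exprS -mulrA => /reg_u; exact: IHn.
have [Q [hQ GQ IQ maxQ]] := exists_maximal hI GI.
exists Q; split=> //; first split=> //.
- by move=> Q1; apply: nP1; apply: (GQ 0%N); rewrite mulr1.
- move=> x y Qxy; apply: contrapT => /not_orP [nQx nQy].
  have meet w : ~ Q w -> exists n s, adjoin Q w (u ^+ n * s) /\ ~ P s.
    move=> nQw; apply: contrapT => none; apply: nQw.
    apply: (maxQ (adjoin Q w)); last exact: adjoin_mem.
    - exact: ideal_adjoin.
    - move=> n s hs; apply: contrapT => nPs.
      by apply: none; exists n, s.
    - exact: sub_adjoin.
  have [n [s [[i [c [Qi es]]] nPs]]] := meet x nQx.
  have [n' [s' [[i' [c' [Qi' es']]] nPs']]] := meet y nQy.
  have : Q (u ^+ (n + n') * (s * s')).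
    have -> : u ^+ (n + n') * (s * s') = (u ^+ n * s) * (u ^+ n' * s').
      by rewrite exprD; ring.
    rewrite es es'.
    have -> : (i + c * x) * (i' + c' * y) =
      (i' + c' * y) * i + (c * x) * i' + (c * c') * (x * y) by ring.
    by apply: idealD => //; [apply: idealD => //|]; exact: ideal_mull.
  by move=> /GQ /pP [].
- by move=> x Qx; apply: (GQ 0%N); rewrite mul1r.
- by move=> Qu; apply: nP1; apply: (GQ 1%N); rewrite expr1 mulr1.
Qed.

(** A maximal colon [(I : z)] is prime: if [x y z] is in [I] and [y z] is not, then [(I : y z)]
    contains [(I : z)], hence equals it, and it contains [x]. *)
Lemma prime_colon_max I r :
    ideal I -> ~ I r ->
  exists z, [/\ ~ I z, sub (colon I r) (colon I z), prime_pred (colon I z)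
    & forall y, ~ I y -> sub (colon I z) (colon I y) ->
        sub (colon I y) (colon I z)].
Proof.
move=> hI nIr; pose G J := exists2 z, ~ I z & J = colon I z.
have Gr : G (colon I r) by exists r.
have [_ [_ [z nIz ->] rz maxz]] := exists_maximal (ideal_colon r hI) Gr.
have maxz' y : ~ I y -> sub (colon I z) (colon I y) -> sub (colon I y) (colon I z).
  by move=> nIy; apply: maxz; [exact: ideal_colon | exists y].
exists z; split=> //; split; first exact: ideal_colon.
  by rewrite /colon mul1r.
move=> x y hxy; case: (pselect (I (y * z))) => [|nIyz]; [by right | left].
apply: (maxz' (y * z)) => //; last by rewrite /colon mulrA.
by move=> w; rewrite /colon mulrCA => hw; exact: ideal_mull.
Qed.

(* If [(I : r) = q] is prime, then either [r t] lies in [(I + z) \ I] for some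
   [t], so that [q = (I : z)], or [q = (I + z : r)]. *)
Lemma finite_associated_primes I : ideal I ->
  exists L : list (R -> Prop),
    forall r, prime_pred (colon I r) -> List.In (colon I r) L.
Proof.
move: I; apply: noetherian_ind => I hI IH.
case: (pselect (I 1)) => [I1|nI1].
  exists [::] => r [_ + _]; case; rewrite /colon mul1r -(mulr1 r).
  exact: ideal_mull.
have [z [nIz _ [_ _ pz] _]] := prime_colon_max hI nI1.
have nadj : ~ sub (adjoin I z) I.
  by move=> h; apply: nIz; apply: h; exact: adjoin_mem.
have [L hL] := IH _ (ideal_adjoin z hI) (@sub_adjoin I z) nadj.
exists (colon I z :: L) => r pr; have [_ nr1 mr] := pr.
case: (pselect (exists2 t, ~ I (t * r) & adjoin I z (t * r))).
  move=> [t nItr [i [c [Ii etr]]]]; left.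
  have key x : I (x * (t * r)) <-> I (x * c * z).
    rewrite etr mulrDr mulrA; split=> h.
      by apply: (@idealBr _ _ (- (x * i))) => //;
        rewrite ?opprK -?mulrN 1?addrC //; apply: ideal_mull => //;
        rewrite -mulN1r; exact: ideal_mull.
    by apply: idealD => //; exact: ideal_mull.
  apply: sub_antisym => x hx.
    have : colon I r (x * t).
      rewrite /colon -mulrA; apply/key; rewrite mulrAC; exact: ideal_mulr.
    by case/mr => // htr; case: nItr.
  have : colon I z (x * c).
    by apply/key; rewrite mulrCA; exact: ideal_mull.
  case/pz => // hc; case: nItr; rewrite -[_ * _]mul1r; apply/key.
  by rewrite mul1r.
move=> none.
have e : colon (adjoin I z) r = colon I r.
  apply: sub_antisym => x hx; last exact: sub_adjoin.
  by apply: contrapT => nIx; apply: none; exists x.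
by right; rewrite -e; apply: hL; rewrite e.
Qed.

(* Prime avoidance; [G] selects a subfamily of [L] without proper inclusions. *)
Lemma prime_avoidance (G : (R -> Prop) -> Prop) (L : list (R -> Prop)) J :
    ideal J -> (forall P, G P -> prime_pred P) -> (forall P, G P -> ~ sub J P) ->
    (forall P Q, G P -> G Q -> sub P Q -> sub Q P) ->
  exists2 x, J x & forall P, List.In P L -> G P -> ~ P x.
Proof.
move=> hJ pG nJ anti; elim: L => [|P L [x Jx hx]].
  by exists 0 => //; case: hJ.
case: (pselect (G P /\ P x)) => [[GP Px]|nGP]; last first.
  exists x => // Q [<- GQ|] Qx; last exact: hx.
  by apply: nGP.
have [hP nP1 pP] := pG P GP.
have [y nPy hy] : exists2 y, ~ P y & forall Q, List.In Q L -> G Q -> Q y.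
  have : forall Q, List.In Q L -> G Q -> ~ sub Q P.
    by move=> Q QL GQ QP; apply: (hx Q QL GQ); exact: (anti Q P GQ GP QP).
  elim: (L) => [|Q L' IH] hL; first by exists 1.
  have [|y nPy hy] := IH; first by move=> Q' ?; apply: hL; right.
  case: (pselect (G Q)) => [GQ|nGQ]; last first.
    by exists y => // Q' [<-|] //; exact: hy.
  have [w Qw nPw] : exists2 w, Q w & ~ P w.
    apply: contrapT => none; apply: (hL Q (or_introl erefl) GQ) => w Qw.
    by apply: contrapT => nPw; apply: none; exists w.
  exists (y * w) => [/pP []|Q' [<-|Q'L] GQ'] //.
    by apply: ideal_mull => //; case: (pG _ GQ).
  by apply: ideal_mulr; [case: (pG _ GQ') | exact: hy].
have [j Jj nPj] : exists2 j, J j & ~ P j.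
  apply: contrapT => none; apply: (nJ P GP) => w Jw.
  by apply: contrapT => nPw; apply: none; exists w.
exists (x + y * j); first by apply: idealD => //; exact: ideal_mull.
move=> Q [<- _ h|QL GQ h].
  have : P (y * j).
    have -> : y * j = (x + y * j) - x by ring.
    exact: idealB.
  by case/pP.
have [hQ _ _] := pG Q GQ; apply: (hx Q QL GQ).
rewrite (_ : x = x + y * j - j * y); last by ring.
by apply: idealB => //; apply: ideal_mull => //; exact: hy.
Qed.

(** * Local rings: depth zero, Nakayama's lemma and chains of primes *)

Section Local.

Variable m : R -> Prop.
Hypotheses (hm : ideal m) (m1 : ~ m 1).
Hypothesis unit_out : forall x, ~ m x -> exists u, u * x = 1.

(** The class of [r] is a nonzero socle element of [R / I]. *)
Definition depth0 I := exists2 r, ~ I r & forall x, m x -> I (x * r).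

(** Every zerodivisor modulo [I] lies in a maximal colon. These colons are finitely many primes, so
    if none contains [m], prime avoidance finds an element of [m] outside all of them. *)
Lemma depth0_or_regular I :
  ideal I -> depth0 I \/ exists2 x, m x & regular_mod I x.
Proof.
move=> hI; case: (pselect (depth0 I)) => [|nd]; [by left | right].
have [L hL] := finite_associated_primes hI.
pose G P := [/\ prime_pred P, (exists2 r, ~ I r & P = colon I r)
  & forall r, ~ I r -> sub P (colon I r) -> sub (colon I r) P].
have [|||x mx hx] := @prime_avoidance G L m hm.
- by move=> P [].
- by move=> _ [_ [r nIr ->] _] h; apply: nd; exists r.
- by move=> P _ [_ _ maxP] [_ [r nIr ->] _]; exact: maxP.
exists x => // s Ixs; apply: contrapT => nIs.
have [z [nIz sz pz maxz]] := prime_colon_max hI nIs.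
by apply: (hx (colon I z)) (sz _ Ixs); [exact: hL | split=> //; exists z].
Qed.

Lemma unit_sub x y : m x -> exists u, u * (1 - x * y) = 1.
Proof.
move=> mx; apply: unit_out => h; apply: m1.
by rewrite -(subrK (x * y) 1); apply: idealD => //; exact: ideal_mulr.
Qed.

Lemma proper_sub_maximal I : ideal I -> ~ I 1 -> sub I m.
Proof.
move=> hI nI1 x Ix; apply: contrapT => /unit_out [u ux].
by apply: nI1; rewrite -ux; exact: ideal_mull.
Qed.

Lemma colon_sub_maximal I z : ideal I -> ~ I z -> sub (colon I z) m.
Proof.
move=> hI nIz; apply: proper_sub_maximal; first exact: ideal_colon.
by rewrite /colon mul1r.
Qed.

(* Nakayama, by removing the generators of [M] modulo [K] one at a time. *)
Lemma ideal_nakayama x K M : m x -> ideal K -> ideal M ->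
    (forall r, M r -> exists v w, [/\ M v, K w & r = x * v + w]) ->
  sub M K.
Proof.
move=> mx hK hM MxM; have [s hs] := ideal_fin_gen hM.
have {hs} : (forall r, M r -> exists i y, [/\ K i, in_span s y & r = i + y])
    /\ (forall y, in_span s y -> M y).
  split=> [r /hs hr|y /hs //]; exists 0, r; split; [by case: hK| |by ring].
  exact: hr.
elim: s => [|z s IHs] [hs sM].
  by move=> r /hs [i [y [Ki /in_span_nil -> ->]]]; rewrite addr0.
apply: IHs; split=> [|y hy]; last first.
  by apply: sM; apply/in_span_cons; exists 0, y; split=> //; ring.
have zM : M z.
  apply: sM; apply/in_span_cons; exists 1, 0; split; last by ring.
  by exists (fun _ => 0); rewrite big1 // => i _; rewrite mul0r.
have scale t y : in_span s y -> in_span s (t * y).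
  move=> [c ->]; exists (fun i => t * c i); rewrite mulr_sumr.
  by apply: eq_bigr => i _; rewrite mulrA.
have add y y' : in_span s y -> in_span s y' -> in_span s (y + y').
  move=> [c ->] [c' ->]; exists (fun i => c i + c' i); rewrite -big_split.
  by apply: eq_bigr => i _; rewrite mulrDl.
(* Expanding [v] in [z = x v + w] puts [z] on the right with coefficient [x d]. As [1 - x d] is a
   unit, [z] is redundant modulo [K]. *)
have [i [y [Ki hy ez]]] : exists i y, [/\ K i, in_span s y & z = i + y].
  have [v [w [/hs [i [_ [Ki /in_span_cons [d [y [hy ->]]] ->]]] Kw ez]]] := MxM z zM.
  have [u eu] := unit_sub d mx.
  exists (u * (x * i + w)), (u * x * y); split; last 1 first.
  - have e1 : (1 - x * d) * z = x * i + x * y + w.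
      by rewrite mulrBl mul1r {1}ez; ring.
    have e2 : z = u * ((1 - x * d) * z) by rewrite mulrA eu mul1r.
    by apply: (etrans e2); rewrite e1; ring.
  - by apply: ideal_mull => //; apply: idealD => //; exact: ideal_mull.
  - exact: scale.
move=> r /hs [i' [_ [Ki' /in_span_cons [d [y' [hy' ->]]] ->]]].
exists (i' + d * i), (d * y + y'); split.
- by apply: idealD => //; exact: ideal_mull.
- by apply: add => //; exact: scale.
- by rewrite ez; ring.
Qed.

(* The ideal of all [r] with [r p] in [I] would lie in [I] by Nakayama if it
   were contained in [I + x]. *)
Lemma annihilated_adjoin I p x : m x -> ideal I -> regular_mod I x ->
    (exists2 r, ~ I r & forall s, p s -> I (r * s)) ->
  exists2 r, ~ adjoin I x r & forall s, p s -> adjoin I x (r * s).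
Proof.
move=> mx hI reg_x [r nIr hr]; apply: contrapT => none; apply: nIr.
pose N t := forall s, p s -> I (t * s).
have hN : ideal N.
  split=> [s _|t t' Nt Nt' s ps|c t Nt s ps].
  - by rewrite mul0r; case: hI.
  - by rewrite mulrDl; apply: idealD => //; [exact: Nt | exact: Nt'].
  - by rewrite -mulrA; apply: ideal_mull => //; exact: Nt.
apply: (@ideal_nakayama x I N) => // t Nt.
have : adjoin I x t.
  apply: contrapT => nt; apply: none; exists t => // s ps.
  by apply: sub_adjoin; exact: Nt.
move=> [i [d [Ii et]]]; exists d, i; split=> //; last by rewrite et; ring.
move=> s ps; apply: reg_x; rewrite mulrA (mulrC x).
have -> : d * x * s = t * s - i * s by rewrite et; ring.
by apply: idealB => //; [exact: Nt | exact: ideal_mulr].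
Qed.

Lemma prime_maximal : prime_pred m.
Proof.
split=> // x y mxy; apply: contrapT => /not_orP [/unit_out [u ux] nmy].
by apply: nmy; rewrite -(mul1r y) -ux -mulrA; exact: ideal_mull.
Qed.

(** Depth is at most dimension: since [z] is regular modulo [I], some prime over [I] inside the
    bottom of a chain over [I + z] misses [z], and it prolongs the chain downwards. *)
Lemma regular_prime_chain I t : ideal I -> sub I m -> (forall z, z \in t -> m z) ->
  regular_over I t -> prime_chain_over I (size t).
Proof.
elim: t I => [|z t IHt] I hI Im tm /=.
  by move=> _; exists (fun _ => m); split=> // _ _; split=> //; exact: prime_maximal.
move=> [reg_z reg_t].
have mz : m z by apply: tm; exact: mem_head.
have [||||P [hP sP]] := IHt (adjoin I z).
- exact: ideal_adjoin.
- exact: adjoin_sub.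
- by move=> w wt; apply: tm; rewrite inE wt orbT.
- by [].
have [pP0 IP0] := hP 0%N isT.
have IP : sub I (P 0%N) by move=> w Iw; apply/IP0/sub_adjoin.
have [Q [pQ IQ QP nQz]] := prime_avoiding_regular hI reg_z pP0 IP.
exists (fun i => if i is k.+1 then P k else Q); split=> [[|i]|[|i]] lt_i //=.
- by have [pP IPi] := hP i lt_i; split=> // w Iw; apply/IPi/sub_adjoin.
- by split=> // h; apply/nQz/h/IP0; exact: adjoin_mem.
- exact: sP.
Qed.

(** An associated prime of [I] containing [p] starts the chain. It misses [z], and its sum with [z]
    again kills a nonzero element modulo [I + z], so the induction continues. *)
Lemma annihilated_prime_chain I p t : ideal I -> (forall z, z \in t -> m z) ->
    regular_over I t -> (exists2 r, ~ I r & forall s, p s -> I (r * s)) ->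
  prime_chain_over p (size t).
Proof.
elim: t I p => [|z t IHt] I p hI tm /= reg_t [r nIr hr].
all: have [q [nIq rq pq _]] := prime_colon_max hI nIr.
all: have pcq : sub p (colon I q) by move=> s /hr h; apply: rq; rewrite /colon mulrC.
  by exists (fun _ => colon I q).
have [reg_z {}reg_t] := reg_t.
have mz : m z by apply: tm; exact: mem_head.
have [|r' nr' hr'] := @annihilated_adjoin I (colon I q) z mz hI reg_z.
  by exists q => // s; rewrite mulrC.
have [||||P [hP sP]] := IHt (adjoin I z) (adjoin (colon I q) z).
- exact: ideal_adjoin.
- by move=> w wt; apply: tm; rewrite inE wt orbT.
- by [].
- exists r' => // _ [i [d [/hr' hi ->]]]; have hA := ideal_adjoin z hI.
  rewrite mulrDr; apply: idealD => //; rewrite mulrA.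
  by apply: ideal_mull => //; exact: adjoin_mem.
have [pP0 IP0] := hP 0%N isT; have hq := ideal_colon q hI.
have qP i : (i <= size t)%N -> sub (colon I q) (P i).
  by move=> /hP [_ IPi] s qs; apply/IPi/sub_adjoin.
exists (fun i => if i is k.+1 then P k else colon I q); split=> [[|i]|[|i]] lt_i //=.
- by have [pP _] := hP i lt_i; split=> // s /pcq; exact: qP.
- split; first exact: qP.
  by move=> h; apply: nIq; apply: reg_z; apply: h; apply: IP0; exact: adjoin_mem.
- exact: sP.
Qed.

End Local.
End Noetherian.
End Ideals.

(** * Descending chains and injective modules *)

Section KrullChain.

Import GRing.Theory.
Local Open Scope ring_scope.

Variable R : comNzRingType.
Implicit Types (I J K P Q c : R -> Prop) (r x y z : R).

Lemma prime_exp P x n : prime_pred P -> P (x ^+ n) -> P x.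
Proof.
case=> _ nP1 pP; elim: n => [|n IHn]; first by rewrite expr0.
by rewrite exprS => /pP [].
Qed.

(** That is, [I = (K : (K : I))] for all ideals [I] over [K]. *)
Definition double_annihilator K :=
  forall I z, ideal I -> sub K I -> ~ I z ->
    exists s, (forall i, I i -> K (s * i)) /\ ~ K (s * z).

Hypothesis noethR : noetherian R.

(** The annihilators [(K : I n)] ascend, hence stabilize, and they determine the ideals [I n]. *)
Lemma double_annihilator_dcc K (I : nat -> R -> Prop) :
    ideal K -> double_annihilator K -> (forall n, ideal (I n)) ->
    (forall n, sub K (I n)) -> (forall n, sub (I n.+1) (I n)) ->
  exists n, sub (I n) (I n.+1).
Proof.
move=> hK daK hI KI Idec; pose C n s := forall i, I n i -> K (s * i).
have hC n : ideal (C n).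
  split=> [i _|s s' Cs Cs' i Ii|r s Cs i Ii].
  - by rewrite mul0r; case: hK.
  - by rewrite mulrDl; apply: idealD => //; [exact: Cs | exact: Cs'].
  - by rewrite -mulrA; apply: ideal_mull => //; exact: Cs.
have [|N hN] := ideal_acc noethR hC.
  by move=> n s Cs i /Idec; exact: Cs.
exists N => z INz; apply: contrapT => nz.
have [s [Cs nKsz]] := daK (I N.+1) z (hI _) (KI _) nz.
by apply: nKsz; apply: (hN N.+1).
Qed.

Variable m : R -> Prop.
Hypotheses (hm : ideal m) (m1 : ~ m 1).
Hypothesis unit_out : forall x, ~ m x -> exists u, u * x = 1.

(* Krull's principal ideal theorem; when [P1] does not contain [x], [I n] below
   is the [n]-th power of [s] in the localization of [R / P0] at [P1]. *)
Lemma no_prime_chain c x P0 P1 P2 :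
    ideal c -> m x -> double_annihilator (adjoin c x) ->
    prime_pred P0 -> prime_pred P1 -> prime_pred P2 -> sub c P0 ->
    sub P0 P1 -> ~ sub P1 P0 -> sub P1 P2 -> ~ sub P2 P1 -> False.
Proof.
move=> hc mx da pP0 pP1 pP2 cP0 P01 nP10 P12 nP21.
have [[hP0 nP01 mP0] [hP1 nP11 mP1] [hP2 nP21' mP2]] := And3 pP0 pP1 pP2.
have hK := ideal_adjoin x hc.
have ex_diff P Q : ~ sub P Q -> exists2 s, P s & ~ Q s.
  move=> nPQ; apply: contrapT => none; apply: nPQ => s Ps.
  by apply: contrapT => nQs; apply: none; exists s.
(* If [P1] contains [x], the powers of [s] stabilize modulo [c + x]. This makes [s] a unit modulo
   [P1], although [s] lies in [P2]. *)
case: (pselect (P1 x)) => [P1x|nP1x].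
  have [s P2s nP1s] := ex_diff _ _ nP21.
  have KP1 : sub (adjoin c x) P1 by apply: adjoin_sub => // y /cP0 /P01.
  have [|||N hN] := @double_annihilator_dcc _ (fun n => adjoin (adjoin c x) (s ^+ n)) hK da.
  - by move=> n; exact: ideal_adjoin.
  - by move=> n; exact: sub_adjoin.
  - move=> n; apply: adjoin_sub; [exact: ideal_adjoin | exact: sub_adjoin|].
    by rewrite exprS; apply: ideal_mull; [exact: ideal_adjoin|exact: adjoin_mem].
  have [k [t [/KP1 P1k es]]] := hN _ (adjoin_mem (s ^+ N) hK).
  have : P1 (s ^+ N * (1 - t * s)).
    have -> : s ^+ N * (1 - t * s) = s ^+ N - t * s ^+ N.+1 by rewrite exprS; ring.
    by rewrite {1}es addrK.
  case/mP1 => [/(prime_exp pP1) //|/P12 h]; apply: nP21'.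
  by rewrite -(subrK (t * s) 1); apply: idealD => //; exact: ideal_mull.
have [s P1s nP0s] := ex_diff _ _ nP10.
pose I n r := exists u, ~ P1 u /\ adjoin P0 (s ^+ n) (u * r).
have hA n : ideal (adjoin P0 (s ^+ n)) by exact: ideal_adjoin.
have hI n : ideal (I n).
  split.
  - by exists 1; split=> //; rewrite mulr0; case: (hA n).
  - move=> r r' [u [nu hu]] [u' [nu' hu']]; exists (u * u').
    split; first by case/mP1.
    have -> : u * u' * (r + r') = u' * (u * r) + u * (u' * r') by ring.
    by apply: idealD => //; exact: ideal_mull.
  - move=> t r [u [nu hu]]; exists u; split=> //.
    by rewrite mulrCA; exact: ideal_mull.
have Idec n : sub (I n.+1) (I n).
  move=> r [u [nu [i [t [P0i eu]]]]]; exists u; split=> //.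
  by exists i, (t * s); split=> //; rewrite eu exprS; ring.
have [|||N hN] := @double_annihilator_dcc _ (fun n => adjoin (I n) x) hK da.
- by move=> n; exact: ideal_adjoin.
- move=> n; apply: adjoin_sub; [exact: ideal_adjoin| |exact: adjoin_mem].
  move=> y /cP0 P0y; apply: sub_adjoin; exists 1; split=> //.
  by rewrite mul1r; exact: sub_adjoin.
- move=> n; apply: adjoin_sub; [exact: ideal_adjoin| |exact: adjoin_mem].
  by move=> y /Idec; exact: sub_adjoin.
(* The ideals [I n] stabilize modulo [x]. As [x] is outside [P1], the cofactor of [x] lies in [I N]
   again, and Nakayama applies. *)
have IN : sub (I N) (I N.+1).
  apply: (@ideal_nakayama _ noethR m hm m1 unit_out x) => // r INr.
  have [i [t [Ii er]]] := hN _ (@sub_adjoin _ _ _ _ INr).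
  exists t, i; split=> //; last by rewrite er; ring.
  have [u [nu hu]] : I N (x * t).
    have -> : x * t = r - i by rewrite er; ring.
    by apply: idealB => //; exact: Idec.
  by exists (u * x); split; [case/mP1 | rewrite -mulrA].
have [|u [nu [i [t [P0i eu]]]]] := IN (s ^+ N).
  by exists 1; split=> //; rewrite mul1r; exact: adjoin_mem.
have : P0 (s ^+ N * (u - t * s)).
  have -> : s ^+ N * (u - t * s) = u * s ^+ N - t * s ^+ N.+1.
    by rewrite exprS; ring.
  by rewrite eu addrK.
case/mP0 => [/(prime_exp pP0) //|/P01 h]; apply: nu.
by rewrite -(subrK (t * s) u); apply: idealD => //; exact: ideal_mull.
Qed.

End KrullChain.

(** * Extension of maps from ideals into injective modules *)

Section InjectiveLift.

Import GRing.Theory.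
Local Open Scope ring_scope.

Variables (S : comNzRingType) (I : S -> Prop) (z : S).
Hypothesis hI : ideal I.

Definition adjoin_pred : {pred S^o} := fun s => `[< adjoin I z s >].

Lemma adjoin_predP s : reflect (adjoin I z s) (s \in adjoin_pred).
Proof. exact: asboolP. Qed.

Lemma adjoin_submod_closed : submod_closed adjoin_pred.
Proof.
have h := ideal_adjoin z hI; split; first by apply/adjoin_predP; case: h.
move=> r u v /adjoin_predP hu /adjoin_predP hv; apply/adjoin_predP.
by apply: idealD => //; exact: ideal_mull.
Qed.

HB.instance Definition _ :=
  GRing.isSubmodClosed.Build S S^o adjoin_pred adjoin_submod_closed.

Definition adjoin_module := {s : S^o | s \in adjoin_pred}.
HB.instance Definition _ := SubType.copy adjoin_module {s : S^o | s \in adjoin_pred}.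
HB.instance Definition _ := Choice.copy adjoin_module {s : S^o | s \in adjoin_pred}.
HB.instance Definition _ := [SubChoice_isSubLmodule of adjoin_module by <:].

(* Extend the linear map [i + d * z |-> d *: u] from [I + z] to the whole ring. *)
Lemma injective_lift (E : lmodType S) (u : E) :
    injective_module E -> (forall s, I (s * z) -> s *: u = 0) ->
  exists v : E, (forall s, I s -> s *: v = 0) /\ z *: v = u.
Proof.
move=> injE hu.
(* The coefficient of [z] is determined only modulo [(I : z)], which kills [u]; so any choice of
   coefficients yields a linear map. *)
have coef (t : adjoin_module) : exists q, I ((val t : S) - q * z).
  have /adjoin_predP [i [q [Ii et]]] := valP t.
  by exists q; rewrite et addrK.
have [q hq] := choice coef.
have eq_coef x y : I (x * z - y * z) -> x *: u = y *: u.
  by move=> h; apply/subr0_eq; rewrite -scalerBl; apply: hu; rewrite mulrBl.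
have g_linear : linear (fun t => q t *: u).
  move=> a t t'; rewrite scalerA -scalerDl; apply: eq_coef.
  have -> : q (a *: t + t') * z - (a * q t + q t') * z =
      a * ((val t : S) - q t * z) + ((val t' : S) - q t' * z)
      - ((val (a *: t + t') : S) - q (a *: t + t') * z).
    have -> : (val (a *: t + t') : S) = a * (val t : S) + (val t' : S).
      by rewrite linearP.
    by ring.
  by apply: idealB => //; apply: idealD => //; exact: ideal_mull.
pose gL := GRing.isLinear.Build S adjoin_module E *:%R (fun t => q t *: u) g_linear.
pose g : {linear adjoin_module -> E} := HB.pack (fun t => q t *: u) gL.
pose f : {linear adjoin_module -> S^o} := val.
have [h hh] := injE adjoin_module S^o f g val_inj.
have hs s (hs : s \in adjoin_pred) : exists r, I (s - r * z) /\ s *: h 1 = r *: u.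
  pose t : adjoin_module := Sub s hs.
  exists (q t); split; first by have := hq t; rewrite SubK.
  transitivity (h (f t)); last exact: hh.
  by rewrite -linearZ; congr (h _); rewrite (_ : f t = s) //; exact: mulr1.
exists (h 1); split=> [s Is|].
  have [|r [Ir ->]] := hs s; first by apply/adjoin_predP; exact: sub_adjoin.
  by apply: hu; rewrite -(subKr s (r * z)); exact: idealB.
have [|r [Ir ->]] := hs z; first by apply/adjoin_predP; exact: adjoin_mem.
rewrite -[RHS]scale1r; apply: eq_coef.
by rewrite mul1r -opprB -mulN1r; exact: ideal_mull.
Qed.

End InjectiveLift.

(** * Ext from an injective resolution *)

Section Resolution.

Import GRing.Theory.
Local Open Scope ring_scope.

Variables (R S : comNzRingType) (f : {rmorphism R -> S}).
Hypothesis f_surj : forall s, exists r, f r = s.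

Variables (E : nat -> lmodType S) (e : {linear (S^o : lmodType S) -> E 0%N}).
Variable d : forall i, {linear E i -> E i.+1}.
Hypothesis E_inj : forall i, injective_module (E i).
Hypothesis e_inj : injective e.
Hypothesis exact0 : forall x, d 0%N x = 0 <-> exists y, e y = x.
Hypothesis exactS : forall i x, d i.+1 x = 0 <-> exists y, d i y = x.

Implicit Types (I J K M : R -> Prop) (r x y z : R).

Local Notation "r ** u" := (f r *: u) (at level 40, left associativity).

(** [S] is the quotient of [R] by [ker]; its ideals are handled as ideals of [R] containing
    [ker]. *)
Definition ker r := f r = 0.
Definition unit_elt r : E 0%N := e (f r).

Lemma ideal_ker : ideal ker.
Proof.
split=> [|x y hx hy|r x hx]; rewrite /ker.
- exact: rmorph0.
- by rewrite rmorphD hx hy addr0.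
- by rewrite rmorphM hx mulr0.
Qed.

Lemma actA j r (s : R) (u : E j) : (r * s) ** u = r ** (s ** u).
Proof. by rewrite rmorphM scalerA. Qed.

Lemma actC j r (s : R) (u : E j) : r ** (s ** u) = s ** (r ** u).
Proof. by rewrite -!actA mulrC. Qed.

Lemma actDl j r (s : R) (u : E j) : (r + s) ** u = r ** u + s ** u.
Proof. by rewrite rmorphD scalerDl. Qed.

Lemma actBl j r (s : R) (u : E j) : (r - s) ** u = r ** u - s ** u.
Proof. by rewrite rmorphB scalerBl. Qed.

Lemma act_ker j r (u : E j) : ker r -> r ** u = 0.
Proof. by move=> ->; rewrite scale0r. Qed.

Lemma d_act j r (u : E j) : d j (r ** u) = r ** d j u.
Proof. by rewrite linearZ. Qed.

Lemma act_unit r s : r ** unit_elt s = unit_elt (r * s).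
Proof. by rewrite /unit_elt rmorphM -linearZ. Qed.

Lemma unit_elt0 r : unit_elt r = 0 <-> ker r.
Proof.
split=> [h|h]; last by rewrite /unit_elt h linear0.
by apply: e_inj; rewrite -/(unit_elt r) h linear0.
Qed.

Lemma unit_eltB r s : unit_elt (r - s) = unit_elt r - unit_elt s.
Proof. by rewrite /unit_elt rmorphB linearB. Qed.

Lemma unit_eltD r s : unit_elt (r + s) = unit_elt r + unit_elt s.
Proof. by rewrite /unit_elt rmorphD linearD. Qed.

Lemma d_unit r : d 0%N (unit_elt r) = 0.
Proof. by apply/exact0; exists (f r). Qed.

Lemma ker_d0 (u : E 0%N) : d 0%N u = 0 -> exists r, u = unit_elt r.
Proof. by move=> /exact0 [s <-]; have [r <-] := f_surj s; exists r. Qed.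

Lemma dd j (u : E j) : d j.+1 (d j u) = 0.
Proof. by apply/exactS; exists u. Qed.

(* [torsion I] is Hom(R / I, E j), and [vanishing j I] states that
   Ext^{j+1}(R / I, S) = 0. *)
Definition torsion I j (u : E j) := forall r, I r -> r ** u = 0.

Definition vanishing j I := forall u : E j.+1, torsion I u -> d j.+1 u = 0 ->
  exists2 v : E j, torsion I v & d j v = u.

Lemma torsion_of_adjoin I z j (u : E j) : torsion (adjoin I z) u -> torsion I u.
Proof. by move=> hu r Ir; apply: hu; exact: sub_adjoin. Qed.

Lemma torsionB I j (u v : E j) : torsion I u -> torsion I v -> torsion I (u - v).
Proof. by move=> hu hv r Ir; rewrite scalerBr hu // hv // subr0. Qed.

Lemma torsion_act I j r (u : E j) : torsion I u -> torsion I (r ** u).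
Proof. by move=> hu s Is; rewrite actC hu // scaler0. Qed.

Lemma torsion_d I j (u : E j) : torsion I u -> torsion I (d j u).
Proof. by move=> hu r Ir; rewrite -d_act hu // linear0. Qed.

Lemma torsion_adjoin I z j (u : E j) :
  torsion I u -> z ** u = 0 -> torsion (adjoin I z) u.
Proof.
by move=> hu zu _ [i [c [Ii ->]]]; rewrite actDl actA zu scaler0 hu // addr0.
Qed.

Lemma torsion_colon I z j (u : E j) : torsion I u -> torsion (colon I z) (z ** u).
Proof. by move=> hu r Ir; rewrite -actA; exact: hu. Qed.

Lemma adjoin_torsion I z j (u : E j) : ideal I -> torsion (adjoin I z) u -> z ** u = 0.
Proof. by move=> hI; apply; exact: adjoin_mem. Qed.

(** Injectivity of [E j], applied to the embedding of [R / (I : z)] into [R / I] by multiplication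
    by [z]. *)
Lemma torsion_lift I z j (u : E j) : ideal I -> sub ker I ->
  torsion (colon I z) u -> exists2 v, torsion I v & z ** v = u.
Proof.
move=> hI kI hu; pose I' s := exists2 r, I r & f r = s.
have I'P r : I' (f r) -> I r.
  move=> [r' Ir' er]; rewrite -(subrK r' r); apply: idealD => //.
  by apply: kI; rewrite /ker rmorphB er subrr.
have hI' : ideal I'.
  split; first by exists 0; [case: hI | exact: rmorph0].
    move=> _ _ [x Ix <-] [y Iy <-]; exists (x + y); last exact: rmorphD.
    exact: idealD.
  move=> s _ [x Ix <-]; have [r <-] := f_surj s.
  by exists (r * x); [exact: ideal_mull | exact: rmorphM].
have [s|v [hv zv]] := injective_lift (z := f z) hI' (u := u) (@E_inj j).
  by have [r <-] := f_surj s; rewrite -rmorphM => /I'P; exact: hu.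
by exists v => // r Ir; apply: hv; exists r.
Qed.

(** Exactness of the long exact sequence at Ext of [R / I]; the next two lemmas use exactness at
    [R / (I : z)] and at [R / (I + z)]. *)
Lemma vanishing_middle j I z : ideal I -> sub ker I ->
  vanishing j (colon I z) -> vanishing j (adjoin I z) -> vanishing j I.
Proof.
move=> hI kI Vc Va u hu du.
have [|g hg eg] := Vc (z ** u) (torsion_colon hu); first by rewrite d_act du scaler0.
have [v hv ev] := torsion_lift hI kI hg.
have [||w hw ew] := Va (u - d j v).
- apply: torsion_adjoin; first by apply: torsionB => //; exact: torsion_d.
  by rewrite scalerBr -d_act ev eg subrr.
- by rewrite linearB /= du dd subrr.
exists (v + w); last by rewrite linearD /= ew addrC subrK.
by move=> r Ir; rewrite scalerDr hv // (torsion_of_adjoin hw) // addr0.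
Qed.

Lemma vanishing_colon j I z : ideal I -> sub ker I ->
  vanishing j I -> vanishing j.+1 (adjoin I z) -> vanishing j (colon I z).
Proof.
move=> hI kI VI Va u hu du; have [v hv ev] := torsion_lift hI kI hu.
have [||w hw ew] := Va (d _ v).
- apply: torsion_adjoin; first exact: torsion_d.
  by rewrite -d_act ev.
- exact: dd.
have [||g hg eg] := VI (v - w).
- by apply: torsionB => //; exact: torsion_of_adjoin hw.
- by rewrite linearB /= ew subrr.
exists (z ** g); first exact: torsion_colon.
by rewrite d_act eg scalerBr ev (adjoin_torsion hI hw) subr0.
Qed.

Lemma vanishing_adjoin j I z : ideal I -> sub ker I ->
  vanishing j (colon I z) -> vanishing j.+1 I -> vanishing j.+1 (adjoin I z).
Proof.
move=> hI kI Vc VI u hu du.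
have [v hv ev] := VI u (torsion_of_adjoin hu) du.
have [||g hg eg] := Vc (z ** v).
- exact: torsion_colon.
- by rewrite d_act ev (adjoin_torsion hI hu).
have [w hw ew] := torsion_lift hI kI hg.
exists (v - d j w); last by rewrite linearB /= dd subr0.
apply: torsion_adjoin; first by apply: torsionB => //; exact: torsion_d.
by rewrite scalerBr -d_act ew eg subrr.
Qed.

Lemma vanishing_ker j : vanishing j ker.
Proof. by move=> u _ /exactS [v <-]; exists v => // r; exact: act_ker. Qed.

(** * Nakayama's lemma for Ext modules *)

Definition submodule j (M : E j -> Prop) :=
  [/\ M 0, forall u v, M u -> M v -> M (u + v) & forall r u, M u -> M (r ** u)].

Lemma submoduleD j (M : E j -> Prop) u v : submodule M -> M u -> M v -> M (u + v).
Proof. by case=> _ + _; apply. Qed.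

Lemma submodule_act j (M : E j -> Prop) r u : submodule M -> M u -> M (r ** u).
Proof. by case=> _ _; apply. Qed.

Lemma submoduleB j (M : E j -> Prop) u v : submodule M -> M u -> M v -> M (u - v).
Proof.
move=> hM Mu Mv; apply: submoduleD => //; rewrite -scaleN1r.
by have -> : -1 = f (-1) by [rewrite rmorphN1]; exact: submodule_act.
Qed.

(** Degree 0 has no nonzero boundaries, so there Ext is Hom(R / I, S). *)
Definition boundary I j : E j -> Prop :=
  if j is k.+1 then fun u => exists2 v : E k, torsion I v & d k v = u
  else fun u => u = 0.

(* Nakayama's lemma for all the quotients [M / K] of submodules of
   Ext^j(R / I, S); unlike finite generation, this is inherited by extensions
   without any appeal to noetherian modules. *)
Definition nakayama x j I := forall K M : E j -> Prop,
  submodule K -> submodule M -> (forall u, boundary I u -> K u) ->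
  (forall u, K u -> M u) -> (forall u, M u -> torsion I u /\ d j u = 0) ->
  (forall u, M u -> exists v w, [/\ M v, K w & u = x ** v + w]) ->
  forall u, M u -> K u.

Lemma boundary_colon I z j (u : E j) : ideal I -> sub ker I ->
  boundary (colon I z) u -> exists v, [/\ torsion I v, z ** v = u & d j v = 0].
Proof.
move=> hI kI; case: j u => [|j] u /=.
  move=> ->; exists 0; split; [by move=> r _; rewrite scaler0|by rewrite scaler0|].
  exact: linear0.
move=> [h /(torsion_lift hI kI) [v hv <-] <-]; exists (d j v); split.
- exact: torsion_d.
- by rewrite d_act.
- exact: dd.
Qed.

(** Inheritance along the exact piece Ext^j(R / (I : z)) -> Ext^{j+1}(R / (I + z)) -> Ext^{j+1}(R /
    I). *)
Lemma nakayama_adjoin x j I z : ideal I -> sub ker I ->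
  nakayama x j (colon I z) -> nakayama x j.+1 I -> nakayama x j.+1 (adjoin I z).
Proof.
move=> hI kI Nc NI K M hK hM bK KM Mc MxM.
have [[K0 KD KZ] [M0 MD MZ]] := (hK, hM).
(* On the right of the sequence: Nakayama for [I] applies to [K] and [M] enlarged by the boundaries
   of [I]. *)
have split_bound u : M u -> exists k v, [/\ K k, torsion I v & u = k + d j v].
  pose bI u := exists2 v : E j, torsion I v & d j v = u.
  pose ext (N : E j.+1 -> Prop) u := exists k v, [/\ N k, torsion I v & u = k + d j v].
  have sub_ext N : submodule N -> submodule (ext N).
    move=> hN; split.
    - exists 0, 0; split; [by case: hN|by move=> r _; rewrite scaler0|].
      by rewrite linear0 addr0.
    - move=> _ _ [k [v [Nk hv ->]]] [k' [v' [Nk' hv' ->]]].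
      exists (k + k'), (v + v'); split; first exact: submoduleD.
        by move=> r Ir; rewrite scalerDr hv // hv' // addr0.
      by rewrite linearD addrACA.
    - move=> r _ [k [v [Nk hv ->]]]; exists (r ** k), (r ** v); split.
      + exact: submodule_act.
      + exact: torsion_act.
      + by rewrite scalerDr d_act.
  move=> Mu; apply: (NI (ext K) (ext M)).
  - exact: sub_ext.
  - exact: sub_ext.
  - by move=> _ [v hv <-]; exists 0, v; split=> //; rewrite add0r.
  - by move=> _ [k [v [Kk hv ->]]]; exists k, v; split=> //; exact: KM.
  - move=> _ [k [v [/Mc [hk dk] hv ->]]]; split; last by rewrite linearD /= dk dd addr0.
    move=> r Ir; rewrite scalerDr (torsion_of_adjoin hk) // add0r.
    by rewrite (torsion_d hv).
  - move=> _ [k [v [/MxM [p [q [Mp Kq ->]]] hv ->]]].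
    exists p, (q + d j v); split; last by rewrite addrA.
      by exists p, 0; split=> //; [move=> r _; rewrite scaler0|rewrite linear0 addr0].
    by exists q, v.
  - by exists u, 0; split=> //; [move=> r _; rewrite scaler0|rewrite linear0 addr0].
(* the preimage of [N] under the connecting map *)
pose conn (N : E j.+1 -> Prop) g := exists v, [/\ torsion I v, z ** v = g & N (d j v)].
have conn_sub N : submodule N -> submodule (conn N).
  move=> hN; split.
  - exists 0; split; [by move=> r _; rewrite scaler0|by rewrite scaler0|].
    by rewrite linear0; case: hN.
  - move=> _ _ [v [hv <- Nv]] [v' [hv' <- Nv']]; exists (v + v'); split.
    + by move=> r Ir; rewrite scalerDr hv // hv' // addr0.
    + by rewrite scalerDr.
    + by rewrite linearD; exact: submoduleD.
  - move=> r _ [v [hv <- Nv]]; exists (r ** v); split.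
    + exact: torsion_act.
    + by rewrite actC.
    + by rewrite d_act; exact: submodule_act.
have LK : forall g, conn M g -> conn K g.
  apply: Nc; try exact: conn_sub.
  - move=> g /(boundary_colon hI kI) [v [hv <- dv]]; exists v; split=> //.
    by rewrite dv.
  - by move=> g [v [hv eg /KM Mv]]; exists v.
  - move=> g [v [hv <- /Mc [tv dv]]]; split; first exact: torsion_colon.
    by rewrite d_act (adjoin_torsion hI tv).
  - move=> g [v [hv <- /MxM [p [q [Mp Kq ev]]]]].
    (* Writing [p = k + d h] turns [p] into a boundary modulo [K]; then [z h] lies in [conn M] and
       [z (v - x h)] in [conn K]. *)
    have [k [h [Kk hh ep]]] := split_bound p Mp.
    exists (z ** h), (z ** (v - x ** h)); split.
    + exists h; split=> //; have -> : d j h = p - k by rewrite ep addrC addKr.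
      by apply: submoduleB => //; exact: KM.
    + exists (v - x ** h); split=> //.
        by apply: torsionB => //; exact: torsion_act.
      rewrite linearB /= d_act ev ep scalerDr.
      have -> : x ** k + x ** d j h + q - x ** d j h = x ** k + q.
        by rewrite addrAC addrK.
      by apply: submoduleD => //; exact: submodule_act.
    + by rewrite scalerBr actC addrC subrK.
move=> u Mu; have [k [h [Kk hh eu]]] := split_bound u Mu.
have [|h' [hh' eh' Kh']] := LK (z ** h).
  exists h; split=> //; have -> : d j h = u - k by rewrite eu addrC addKr.
  by apply: submoduleB => //; exact: KM.
(* Since [h - h'] is killed by [I + z], its boundary lies in [K]. *)
rewrite eu; apply: submoduleD => //; rewrite -(subrK h' h) linearD.
apply: submoduleD => //; apply: bK; exists (h - h') => //.
apply: torsion_adjoin; first exact: torsionB.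
by rewrite scalerBr eh' subrr.
Qed.

Lemma nakayama_ker_succ x j : nakayama x j.+1 ker.
Proof.
move=> K M _ _ bK _ Mc _ u /Mc [_ /exactS [v ev]]; apply: bK.
by exists v => // r; exact: act_ker.
Qed.

(** * Vanishing of Ext over a local ring *)

Section Local.

Hypothesis noethR : noetherian R.
Variable m : R -> Prop.
Hypotheses (hm : ideal m) (m1 : ~ m 1).
Hypothesis unit_out : forall x, ~ m x -> exists u, u * x = 1.

(** Cocycles in degree 0 are elements of [S], so submodules pull back to ideals of [R]. *)
Lemma nakayama_zero x I : m x -> nakayama x 0 I.
Proof.
move=> mx K M hK hM _ KM Mc MxM u Mu.
have [r er] := ker_d0 (Mc u Mu).2; rewrite er.
have hP (N : E 0%N -> Prop) : submodule N -> ideal (fun r => N (unit_elt r)).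
  move=> hN; split=> [|r' s hr hs|r' s hs].
  - by rewrite (unit_elt0 0).2; [case: hN | exact: rmorph0].
  - by rewrite unit_eltD; exact: submoduleD.
  - by rewrite -act_unit; exact: submodule_act.
apply: (ideal_nakayama noethR hm m1 unit_out mx (hP K hK) (hP M hM)); last first.
  by rewrite -er.
move=> s /MxM [v [w [Mv Kw es]]]; have [t et] := ker_d0 (Mc v Mv).2.
exists t, (s - x * t); rewrite -et; split=> //; last by ring.
by rewrite unit_eltB -act_unit -et es addrC addKr.
Qed.

(** Induction on the degree and, in each positive degree, on the generators of [I] over [ker],
    starting from the vanishing of Ext for [ker]. *)
Lemma nakayama_ext x j I : m x -> ideal I -> sub ker I -> nakayama x j I.
Proof.
move=> mx; elim: j I => [|j IHj] I hI kI; first exact: nakayama_zero.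
move: I hI kI; apply: (ideal_adjoin_ind noethR ideal_ker); first exact: nakayama_ker_succ.
move=> I z hI kI NI; apply: nakayama_adjoin => //; apply: IHj.
  exact: ideal_colon.
by move=> r /kI; exact: sub_colon.
Qed.

(** Here [(I : x) = I], so the vanishing for [I + x] makes multiplication by [x] surjective on
    Ext^{j+1}(R / I, S). Nakayama, for cocycles over boundaries, gives zero. *)
Lemma vanishing_regular j I x : m x -> ideal I -> sub ker I ->
  regular_mod I x -> vanishing j.+1 (adjoin I x) -> vanishing j I.
Proof.
move=> mx hI kI reg_x V u hu du.
pose Z u := torsion I u /\ d j.+1 u = 0.
have hZ : submodule Z.
  split; first by split; [move=> r _; rewrite scaler0 | rewrite linear0].
  - move=> v w [hv dv] [hw dw]; split; last by rewrite linearD /= dv dw addr0.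
    by move=> r Ir; rewrite scalerDr hv // hw // addr0.
  - by move=> r v [hv dv]; split; [exact: torsion_act | rewrite d_act dv scaler0].
have hB : submodule (@boundary I j.+1).
  split; first by exists 0; [move=> r _; rewrite scaler0 | rewrite linear0].
  - move=> _ _ [v hv <-] [w hw <-]; exists (v + w); last by rewrite linearD.
    by move=> r Ir; rewrite scalerDr hv // hw // addr0.
  - by move=> r _ [v hv <-]; exists (r ** v); [exact: torsion_act | rewrite d_act].
apply: (@nakayama_ext x j.+1 I mx hI kI (@boundary I j.+1) Z) => //.
- move=> _ [v hv <-]; split; [exact: torsion_d | exact: dd].
- move=> v [hv dv].
  have [|w hw ew] := @torsion_lift I x _ v hI kI.
    by move=> r; rewrite /colon mulrC => /reg_x; exact: hv.
  have [||h hh eh] := V (d _ w).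
  + by apply: torsion_adjoin; [exact: torsion_d | rewrite -d_act ew].
  + exact: dd.
  exists (w - h), 0; split; [split| |].
  + by apply: torsionB => //; exact: torsion_of_adjoin hh.
  + by rewrite linearB /= eh subrr.
  + by case: hB.
  + by rewrite scalerBr ew (adjoin_torsion hI hh) subr0 addr0.
Qed.

(* Bass: descend from one cohomological degree to the previous one. *)
Lemma vanishing_descent j K : ideal K -> sub ker K -> depth0 m K ->
    vanishing j K -> (forall I, ideal I -> sub ker I -> vanishing j.+1 I) ->
  forall I, ideal I -> sub ker I -> vanishing j I.
Proof.
move=> hK kK [r0 nKr0 mK] VK V.
have colon_m J z : ideal J -> ~ J z -> (forall x, m x -> J (x * z)) -> colon J z = m.
  move=> hJ nJz h; apply: sub_antisym; last by move=> x; exact: h.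
  exact: (colon_sub_maximal unit_out).
(* The residue field is [R / (K : r0)], so the long exact sequence applies. *)
have Vm : vanishing j m.
  rewrite -(colon_m K r0) //; apply: vanishing_colon => //.
  apply: V; first exact: ideal_adjoin.
  by move=> x /kK; exact: sub_adjoin.
(* If [R / I] has depth 0, split off a copy of the residue field; otherwise add a regular element
   and use degree [j.+1]. *)
apply: (noetherian_ind noethR) => I hI IH kI.
have [[z nIz mz]|[x mx reg_x]] := depth0_or_regular noethR hm hI.
  apply: (@vanishing_middle _ _ z) => //; first by rewrite colon_m.
  apply: IH; first exact: ideal_adjoin.
  - exact: sub_adjoin.
  - by move=> h; apply: nIz; apply: h; exact: adjoin_mem.
  - by move=> y /kI; exact: sub_adjoin.
apply: (vanishing_regular mx) => //; apply: V; first exact: ideal_adjoin.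
by move=> y /kI; exact: sub_adjoin.
Qed.

Lemma vanishing_adjoin_regular j I x : ideal I -> sub ker I -> regular_mod I x ->
  vanishing j I -> vanishing j.+1 I -> vanishing j.+1 (adjoin I x).
Proof.
move=> hI kI reg_x V V'; apply: vanishing_adjoin => //.
have -> // : colon I x = I.
by apply: sub_antisym => r; [rewrite /colon mulrC; exact: reg_x | exact: sub_colon].
Qed.

Variable n : nat.
Hypothesis E_zero : forall i, (n < i)%N -> forall u : E i, u = 0.

(** The descent starts beyond [n], where the resolution is zero, and [k] counts its steps. *)
Lemma vanishing_all t K : ideal K -> sub ker K -> depth0 m K ->
    (forall j, vanishing (t + j) K) ->
  forall I, ideal I -> sub ker I -> vanishing t I.
Proof.
move=> hK kK dK VK.
suff h k I : ideal I -> sub ker I -> vanishing (t + (n - k)) I.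
  by move=> I; rewrite -(addn0 t) -(subnn n); exact: h.
elim: k I => [|k IHk] I hI kI.
  move=> u _ _; exists 0; first by move=> r _; rewrite scaler0.
  by rewrite linear0 [u]E_zero // subn0 ltnS leq_addl.
(* For [k >= n] truncated subtraction makes both degrees equal to [t]. *)
case: (ltnP k n) => [lt_kn|le_nk]; last first.
  have -> : (n - k.+1 = n - k)%N by apply/eqP; rewrite eqn_leq; lia.
  exact: IHk.
apply: (@vanishing_descent _ K) => // J hJ kJ.
by rewrite -addnS subnSK //; exact: IHk.
Qed.

(** All Ext^1(R / I, S) vanish. As [(I : z)] lies in [m], it kills the socle element [r]; the
    resulting map from [R / (I : z)] to [S] extends to [R / I], which gives [s] killing [I] with
    [s z = r]. *)
Lemma double_annihilator_ker : depth0 m ker -> double_annihilator ker.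
Proof.
move=> d0 I z hI kI nIz; have [r nr mr] := d0.
have V := @vanishing_all 0 ker ideal_ker (fun _ => id) d0 (fun j => @vanishing_ker _).
have [|g hg eg] := @torsion_lift I z _ (unit_elt r) hI kI.
  move=> x /(colon_sub_maximal unit_out hI nIz) mx.
  by rewrite act_unit; apply/unit_elt0; exact: mr.
have [||||h hh eh] := V (adjoin I z) _ _ (d _ g).
- exact: ideal_adjoin.
- by move=> x /kI; exact: sub_adjoin.
- by apply: torsion_adjoin; [exact: torsion_d | rewrite -d_act eg d_unit].
- exact: dd.
have [|s es] := @ker_d0 (g - h); first by rewrite linearB /= eh subrr.
exists s; split=> [i Ii|ksz].
  apply/unit_elt0; rewrite mulrC -act_unit -es scalerBr hg // sub0r.
  by rewrite (torsion_of_adjoin hh) ?oppr0.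
have e1 : z ** (g - h) = unit_elt r.
  by rewrite scalerBr eg (adjoin_torsion hI hh) subr0.
by apply: nr; apply/unit_elt0; rewrite -e1 es act_unit mulrC; apply/unit_elt0.
Qed.

(** * Reduction modulo a regular element *)

Section Regular.

Variable x : R.
Hypothesis reg_x : regular_mod ker x.

(** The element [w] plays the role of [1 / x]. *)
Lemma exists_fraction : exists w : E 0%N, x ** w = unit_elt 1.
Proof.
have [|w _ ew] := @torsion_lift ker x _ (unit_elt 1) ideal_ker (fun _ => id).
  by move=> r; rewrite /colon mulrC => /reg_x kr; rewrite act_ker.
by exists w.
Qed.

(* If [x ** w = unit_elt 1], then [r |-> r ** d w] embeds [R / (ker + x)] into [E 1]. *)
Lemma fraction_ker w h s : x ** w = unit_elt 1 -> x ** h = 0 ->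
  d 0%N (s ** w + h) = 0 -> adjoin ker x s.
Proof.
move=> ew xh /ker_d0 [t et]; exists (s - t * x), t; split; last by ring.
apply/unit_elt0; rewrite unit_eltB mulrC -act_unit -et scalerDr xh addr0.
by rewrite actC ew act_unit mulr1 subrr.
Qed.

Lemma fraction_adjoin w s : x ** w = unit_elt 1 -> adjoin ker x s -> s ** d 0%N w = 0.
Proof.
move=> ew [k [t [kk ->]]]; rewrite actDl act_ker // add0r actA -d_act ew d_unit.
by rewrite scaler0.
Qed.

Lemma vanishing_ker_adjoin j : vanishing j.+1 (adjoin ker x).
Proof.
by apply: vanishing_adjoin_regular => //; [exact: ideal_ker | exact: vanishing_ker..].
Qed.

(** The argument for [ker] is repeated for [S / x], embedded in [E 1] as the multiples of [d w],
    with Ext^2 in place of Ext^1. *)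
Lemma double_annihilator_adjoin :
  depth0 m (adjoin ker x) -> double_annihilator (adjoin ker x).
Proof.
move=> d0 I z hI KI nIz; have [r nr mr] := d0.
have hK := ideal_adjoin x ideal_ker.
have kK := @sub_adjoin _ ker x.
have V := @vanishing_all 1 _ hK kK d0 (fun j => @vanishing_ker_adjoin _).
have kI : sub ker I by move=> y /kK /KI.
have Ix : I x by apply: KI; apply: adjoin_mem; exact: ideal_ker.
have [w ew] := exists_fraction.
have [|g hg eg] := @torsion_lift I z _ (r ** d 0%N w) hI kI.
  move=> y /(colon_sub_maximal unit_out hI nIz) my.
  by rewrite -actA; apply: fraction_adjoin => //; exact: mr.
have [||||h hh eh] := V (adjoin I z) _ _ (d _ g).
- exact: ideal_adjoin.
- by move=> y /kI; exact: sub_adjoin.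
- apply: torsion_adjoin; first exact: torsion_d.
  by rewrite -d_act eg d_act dd scaler0.
- exact: dd.
have tgh : torsion I (g - h) by apply: torsionB => //; exact: torsion_of_adjoin hh.
(* As [x] is in [I], it kills [g - h = d q]; so [x q] is some [s] in [S], and [q] is [s w] up to an
   element [p] killed by [x]. *)
have [|q eq] := (@exactS 0%N (g - h)).1; first by rewrite linearB /= eh subrr.
have [|s es] := @ker_d0 (x ** q); first by rewrite d_act eq tgh.
have [p xp ep] : exists2 p, x ** p = 0 & d 0%N (s ** w + p) = g - h.
  exists (q - s ** w); last by rewrite addrC subrK.
  by rewrite scalerBr es actC ew act_unit mulr1 subrr.
have nz y : x ** (y ** p) = 0 by rewrite actC xp scaler0.
exists s; split=> [i Ii|Ksz].
  apply: (fraction_ker ew (nz i)).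
  by rewrite mulrC actA -scalerDr d_act ep tgh.
apply: nr; rewrite -(subrK (s * z) r); apply: idealD => //.
apply: (@fraction_ker w (- (z ** p))) => //; first by rewrite scalerN nz oppr0.
have -> : (r - s * z) ** w - z ** p = r ** w - z ** (s ** w + p).
  by rewrite actBl scalerDr opprD addrA (mulrC s z) actA.
by rewrite linearB /= !d_act ep scalerBr (adjoin_torsion hI hh) subr0 eg subrr.
Qed.

(* Dividing by [x] turns [w] into a homomorphism from [b] to [R / ker], which
   is a multiplication because Ext^1(R / b, S) = 0. *)
Lemma colon_adjoin b r : sub ker b -> vanishing 0 b ->
    (forall y, b y -> adjoin ker x (r * y)) ->
  exists t, forall y, b y -> ker ((r - t * x) * y).
Proof.
move=> kb V hr; have [w ew] := exists_fraction.
have [||h hh eh] := V (r ** d 0%N w).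
- by move=> y /hr; rewrite -actA mulrC; exact: fraction_adjoin.
- by rewrite d_act dd scaler0.
have [|t et] := @ker_d0 (r ** w - h).
  by rewrite linearB /= eh d_act subrr.
exists t => y yb; apply/unit_elt0.
have -> : (r - t * x) * y = r * y - x * (y * t) by ring.
have e1 : y ** unit_elt t = y ** (r ** w).
  by rewrite -et scalerBr hh // subr0.
rewrite unit_eltB -(act_unit x) -(act_unit y) e1 -!actA.
by rewrite (_ : x * y * r = r * y * x); [rewrite actA ew act_unit mulr1 subrr | ring].
Qed.

End Regular.

(** * Linked ideals *)

Section Linked.

Variables a b : R -> Prop.
Hypotheses (hb : ideal b) (a1 : ~ a 1).
Hypothesis aE : forall x, a x <-> forall y, b y -> ker (x * y).
Hypothesis bE : forall x, b x <-> forall y, a y -> ker (x * y).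
Hypothesis chain2 : prime_chain_over a 2.
Hypothesis chain3 : ~ prime_chain_over a 3.

Lemma linked_annihilated : exists2 r, ~ ker r & forall s, a s -> ker (r * s).
Proof.
apply: contrapT => none; apply: a1; apply/aE => y by_; rewrite mul1r.
apply: contrapT => nky; apply: none; exists y => // s as_.
by rewrite mulrC; move/aE: as_; apply.
Qed.

(* [S] has depth 2: at least 2 because [R / a] has dimension at least 2, and
   at most 2 because [a] annihilates a nonzero element of [S]. *)
Lemma linked_regular_pair : exists x y,
  [/\ m x, m y, regular_mod ker x, regular_mod (adjoin ker x) y
    & forall I, ideal I -> sub ker I -> vanishing 2 I].
Proof.
have [P [hP sP]] := chain2.
have [[pP0 aP0] [pP1 _] [pP2 _]] := And3 (hP 0%N isT) (hP 1%N isT) (hP 2%N isT).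
have [[sP01 nP10] [sP12 nP21]] := (sP 0%N isT, sP 1%N isT).
have ka : sub ker a.
  by move=> x kx; apply/aE => y _; exact: (ideal_mulr y ideal_ker kx).
(* The three primes over [a] rule out the double annihilator property, hence depth 0 (with [z = 0])
   and depth 1 (with [z = x]). *)
have no_da z : m z -> ~ double_annihilator (adjoin ker z).
  move=> mz da; apply: (no_prime_chain noethR hm m1 unit_out ideal_ker mz da pP0 pP1 pP2) => //.
  by move=> x /ka /aP0.
have [d0|[x mx reg_x]] := depth0_or_regular noethR hm ideal_ker.
  case: (no_da 0); first by case: hm.
  have -> : adjoin ker 0 = ker; last exact: double_annihilator_ker.
  apply: sub_antisym; last exact: sub_adjoin.
  by apply: adjoin_sub => //; [exact: ideal_ker | exact: rmorph0].
have hKx := ideal_adjoin x ideal_ker.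
have [d1|[y my reg_y]] := depth0_or_regular noethR hm hKx.
  by case: (no_da x mx); exact: double_annihilator_adjoin.
have hKxy := ideal_adjoin y hKx.
have [d2|[z mz reg_z]] := depth0_or_regular noethR hm hKxy; last first.
  case: chain3; apply: (annihilated_prime_chain noethR hm m1 unit_out
    (t := [:: x; y; z]) ideal_ker _ _ linked_annihilated) => //=.
  by move=> w; rewrite !inE => /or3P [] /eqP ->.
(* [vanishing 2] concerns Ext^3, one above the depth of [S]; the ideal [ker + x + y] of depth 0
   drives the descent. *)
exists x, y; split=> //.
have kx : sub ker (adjoin ker x) by exact: sub_adjoin.
apply: (vanishing_all hKxy _ d2) => [w /kx|j]; first exact: sub_adjoin.
by apply: vanishing_adjoin_regular => //; exact: vanishing_ker_adjoin.
Qed.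

(** Multiplication by the elements of [b] embeds [R / a] into a product of copies of [S]. *)
Lemma regular_colon x : regular_mod ker x -> regular_mod a x.
Proof.
move=> reg_x r /aE h; apply/aE => y by_; apply: reg_x.
by rewrite mulrA; exact: h.
Qed.

Lemma linked_depth : exists x y,
  [/\ m x, m y, regular_mod ker x & forall u v, m u -> m v ->
      regular_mod b u -> regular_mod (adjoin b u) v -> regular_mod (adjoin a x) y].
Proof.
have [x [y [mx my reg_x reg_y V]]] := linked_regular_pair.
exists x, y; split=> // u v mu mv reg_u reg_v.
have kb : sub ker b.
  by move=> w kw; apply/bE => s _; exact: (ideal_mulr s ideal_ker kw).
have kbu : sub ker (adjoin b u) by move=> w /kb; exact: sub_adjoin.
have hbu := ideal_adjoin u hb.
(* Each regular element lowers the degree by one, from Ext^3 for [b + u + v] to Ext^1 for [b]. *)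
have Vb : vanishing 0 b.
  apply: (vanishing_regular mu) => //; apply: (vanishing_regular mv) => //.
  by apply: V; [exact: ideal_adjoin | move=> w /kbu; exact: sub_adjoin].
move=> r [i [t [/aE ai er]]].
(* If [y r] is in [a + x], then [y r b] lies in [ker + x], hence so does [r b], as [y] is regular
   there. So [r] is in [(x : b) = a + x]. *)
have [s b_y|q hq] := colon_adjoin reg_x (r := r) kb Vb.
  apply: reg_y; rewrite mulrA er mulrDl; apply: idealD.
  - exact: ideal_adjoin ideal_ker.
  - by apply: sub_adjoin; exact: ai.
  - by exists 0, (t * s); split; [exact: rmorph0 | ring].
exists (r - q * x), q; split; last by ring.
exact/aE.
Qed.

End Linked.

End Local.

End Resolution.

(** * Quotient rings *)

Section LocalRing.

Import GRing.Theory.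
Local Open Scope ring_scope.

Variable R : comNzRingType.

(** A nonunit lies in an ideal maximal among the proper ones, which must be [m]. *)
Lemma local_unit_out (m : idealr R) : noetherian R -> local_with m ->
  forall x, ~ x \in m -> exists u, u * x = 1.
Proof.
move=> noethR [_ uniq_m] x nmx; apply: contrapT => nux.
have h0 : ideal (fun r : R => r = 0).
  by split=> [//|r s -> ->|r s ->]; rewrite ?addr0 ?mulr0.
have n1 : ~ adjoin (fun r : R => r = 0) x 1.
  by move=> [_ [u [-> e1]]]; apply: nux; exists u; rewrite e1 add0r.
have [I [hI nI1 xI maxI]] :=
  exists_maximal noethR (G := fun I => ~ I 1) (ideal_adjoin x h0) n1.
have [J hJ] := idealr_of_ideal hI nI1.
have maxJ : maximal_ideal J.
  move=> K JK y; apply/idP/idP => [Ky|/JK //].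
  apply/hJ; apply: (maxI (fun r => r \in K)) => //.
  - exact: ideal_idealr.
  - by rewrite idealr1.
  - by move=> r /hJ /JK.
apply: nmx; rewrite -(uniq_m J maxJ); apply/hJ/xI; exact: adjoin_mem.
Qed.

Lemma local_of_unit_out (m : idealr R) :
  (forall x, ~ x \in m -> exists u, u * x = 1) -> local_with m.
Proof.
move=> unit_out.
have sub_m (J : idealr R) : {subset J <= m}.
  move=> x Jx; apply: contrapT => /unit_out [u ux].
  by have := idealr1 J; rewrite -ux idealMr.
split=> [J mJ x|J maxJ x]; first by apply/idP/idP => [/sub_m|/mJ].
by rewrite (maxJ m (sub_m J)).
Qed.

End LocalRing.

(** * Regular sequences, prime chains and depth of a quotient, computed in [R] *)

Section Quotient.

Import GRing.Theory.
Local Open Scope ring_scope.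

Variables (R Q : comNzRingType) (g : {rmorphism R -> Q}).
Hypothesis g_surj : forall q, exists r, g r = q.

Local Notation a := (ker g).

Lemma in_span_map s x : in_span (map g s) (g x) <-> foldl (@adjoin R) a s x.
Proof.
rewrite foldl_adjoinP; elim: s x => [|z s IHs] x /=.
  rewrite in_span_nil; split=> [kx|[i [y [ki /in_span_nil -> ->]]]].
    by exists x, 0; split=> //; [exact/in_span_nil | rewrite addr0].
  by rewrite addr0.
rewrite in_span_cons; split.
  move=> [q [y [hy ex]]]; have [d ed] := g_surj q.
  have [|i [y' [ki hy' ex']]] := (IHs (x - d * z)).1.
    by rewrite rmorphB rmorphM ed ex addrC addKr.
  exists i, (d * z + y'); split=> //; first by apply/in_span_cons; exists d, y'.
  by rewrite addrCA -ex' addrC subrK.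
move=> [i [_ [ki /in_span_cons [d [y [hy ->]]] ->]]].
exists (g d), (g (i + y)); split; last by rewrite !rmorphD rmorphM addrCA.
by apply/IHs; exists i, y.
Qed.

Lemma regular_overP (I : R -> Prop) s :
  regular_over I s <->
  (forall i, (i < size s)%N -> regular_mod (foldl (@adjoin R) I (take i s)) s`_i).
Proof.
elim: s I => [|z s IHs] I //=; split.
  by move=> [reg_z /IHs h] [|i] //=; rewrite ?ltnS; exact: h.
by move=> h; split; [exact: (h 0%N) | apply/IHs => i; exact: (h i.+1)].
Qed.

Lemma regular_seq_map s :
  regular_seq (map g s) <-> regular_over a s /\ ~ foldl (@adjoin R) a s 1.
Proof.
rewrite /regular_seq -(rmorph1 g) in_span_map regular_overP size_map.
split=> -[h n1]; split=> // i lt_i.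
  move=> r; rewrite -!in_span_map map_take rmorphM -(nth_map 0 0) //; exact: h.
move=> y; have [r <-] := g_surj y.
by rewrite (nth_map 0) // -rmorphM -map_take !in_span_map; exact: h.
Qed.

Lemma prime_chain_ker n : prime_chain Q n <-> prime_chain_over a n.
Proof.
split.
  move=> [P sP]; exists (fun i r => g r \in P (inord i)); split=> i lt_i.
    split; last by move=> r kr; rewrite kr; exact: idealr0.
    split; [split=> [|x y|r x]|by rewrite rmorph1 idealr1|move=> x y h].
    - by rewrite rmorph0 idealr0.
    - by rewrite rmorphD; exact: rpredD.
    - by rewrite rmorphM; exact: idealMr.
    - by apply/orP; rewrite -prime_idealrM -rmorphM.
  have lt_ord : ((inord i : 'I_n.+1) < (inord i.+1 : 'I_n.+1))%N.
    by rewrite (inordK (leqW lt_i)) inordK.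
  have [sub_i nsub_i] := sP _ _ lt_ord; split; first by move=> r; exact: sub_i.
  by move=> h; apply: nsub_i => q; have [r <-] := g_surj q; exact: h.
move=> [P [hP sP]].
have mono i j : (i <= j)%N -> (j <= n)%N -> sub (P i) (P j).
  elim: j => [|j IHj]; first by rewrite leqn0 => /eqP -> _ x.
  rewrite leq_eqVlt => /predU1P [-> _ x //|]; rewrite ltnS => le_ij lt_jn x Px.
  by apply: (sP j lt_jn).1; apply: IHj => //; exact: ltnW.
have img (i : 'I_n.+1) : exists J : prime_idealr Q, forall r, (g r \in J) <-> P i r.
  have [[[P0 PD PM] nP1 pP] kP] := hP i (ltn_ord i).
  pose J q := exists2 r, P i r & g r = q.
  have JP r : J (g r) -> P i r.
    move=> [r' Pr' er]; rewrite -(subrK r' r); apply: PD => //.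
    by apply: kP; rewrite /ker rmorphB er subrr.
  have pJ : prime_pred J.
    split; [split| |].
    - by exists 0; rewrite ?rmorph0.
    - by move=> _ _ [x Px <-] [y Py <-]; exists (x + y); [exact: PD | exact: rmorphD].
    - move=> q _ [x Px <-]; have [r <-] := g_surj q.
      by exists (r * x); [exact: PM | exact: rmorphM].
    - by rewrite -(rmorph1 g) => /JP.
    - move=> q q'; have [x <-] := g_surj q; have [y <-] := g_surj q'.
      by rewrite -rmorphM => /JP /pP [h|h]; [left; exists x | right; exists y].
  have [K hK] := prime_idealr_of_prime pJ; exists K => r.
  by rewrite hK; split=> [/JP|h] //; exists r.
have [J hJ] := choice img.
exists J => i j lt_ij; split=> [q|h].
  have [r <-] := g_surj q; move=> /hJ h; apply/hJ.
  by apply: mono h; [exact: ltnW | rewrite -ltnS].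
have lt_in : (i < n)%N by rewrite -ltnS; apply: leq_trans (ltn_ord j); rewrite ltnS.
apply: (sP i lt_in).2 => r /(mono i.+1 j lt_ij) Pj.
by apply/hJ/h/hJ/Pj; rewrite -ltnS.
Qed.

Hypothesis noethR : noetherian R.

Lemma noetherian_quotient : noetherian Q.
Proof.
move=> J.
have hJ : ideal (fun r => g r \in J).
  split=> [|x y|r x]; first by rewrite rmorph0 idealr0.
    by rewrite rmorphD; exact: rpredD.
  by rewrite rmorphM; exact: idealMr.
have [s hs] := ideal_fin_gen noethR hJ; exists (map g s) => q.
have [x <-] := g_surj q; rewrite in_span_map foldl_adjoinP; split.
  by move=> /hs hx; exists 0, x; split=> //; [exact: rmorph0 | rewrite add0r].
move=> [i [y [ki /hs Jy ->]]]; rewrite rmorphD ki add0r; exact: Jy.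
Qed.

Variable m : R -> Prop.
Hypotheses (hm : ideal m) (m1 : ~ m 1).
Hypothesis unit_out : forall x, ~ m x -> exists u, u * x = 1.

Lemma ker_sub_maximal : sub a m.
Proof.
apply: (proper_sub_maximal unit_out (ideal_ker g)).
by rewrite /ker rmorph1; apply/eqP; exact: oner_neq0.
Qed.

Lemma local_quotient :
  exists2 mQ : idealr Q, local_with mQ & forall r, (g r \in mQ) <-> m r.
Proof.
pose J q := exists2 r, m r & g r = q.
have JP r : J (g r) -> m r.
  move=> [r' mr' er]; rewrite -(subrK r' r); apply: idealD => //.
  by apply: ker_sub_maximal; rewrite /ker rmorphB er subrr.
have hJ : ideal J.
  split.
  - by exists 0; [case: hm | exact: rmorph0].
  - by move=> _ _ [x mx <-] [y my <-]; exists (x + y); [exact: idealD | exact: rmorphD].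
  - move=> q _ [x mx <-]; have [r <-] := g_surj q.
    by exists (r * x); [exact: ideal_mull | exact: rmorphM].
have [|mQ hmQ] := idealr_of_ideal hJ; first by rewrite -(rmorph1 g) => /JP.
have mQE r : (g r \in mQ) <-> m r.
  by rewrite hmQ; split=> [/JP|mr] //; exists r.
exists mQ => //; apply: local_of_unit_out => q; have [r <-] := g_surj q.
move=> nr; have [|u eu] := unit_out (x := r); first by move/mQE.
by exists (g u); rewrite -rmorphM eu rmorph1.
Qed.

Lemma has_depth_quotient n :
    (exists s, [/\ forall z, z \in s -> m z, regular_over a s & size s = n]) ->
    (forall s, (forall z, z \in s -> m z) -> regular_over a s -> (size s <= n)%N) ->
  has_depth Q n.
Proof.
move=> [s [sm reg_s size_s]] ub; have [mQ locQ mQE] := local_quotient.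
exists mQ; split=> //.
  exists (map g s); split; last by rewrite size_map.
    by move=> _ /mapP [r /sm mr ->]; apply/mQE.
  (* The kernel and [s] lie in [m], so together they do not generate 1. *)
  apply/regular_seq_map; split=> // /foldl_adjoinP [i [y [/ker_sub_maximal mi hy e1]]].
  apply: m1; rewrite e1; apply: idealD => //.
  by apply: (ideal_in_span hm _ hy) => j lt_j; apply/sm/mem_nth.
move=> t tm; have [t' et] : exists t', t = map g t'.
  elim: (t) => [|q t0 [t1 ->]]; first by exists [::].
  by have [r <-] := g_surj q; exists (r :: t1).
rewrite et size_map => /regular_seq_map [reg_t _]; apply: ub => // z zt.
by apply/mQE/tm; rewrite et; exact: map_f.
Qed.

End Quotient.

Section IdealQuotient.

Import GRing.Theory.
Local Open Scope ring_scope.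
Local Open Scope quotient_scope.

Variables (R : comNzRingType) (I : idealr R).

Definition quot_proj : {rmorphism R -> {ideal_quot I}} := \pi_{ideal_quot I}.

Lemma quot_proj_surj q : exists r, quot_proj r = q.
Proof. by exists (repr q); exact: reprK. Qed.

Lemma ker_quot_proj : ker quot_proj = (fun r => r \in I).
Proof.
apply/predeqP => r; rewrite /ker.
have -> : (r \in I) = (quot_proj r == quot_proj 0).
  by rewrite -{1}(subr0 r) Quotient.idealrBE.
by rewrite rmorph0; split=> [h|/eqP //]; apply/eqP.
Qed.

End IdealQuotient.

Section LinkedQuotients.

Import GRing.Theory.
Local Open Scope ring_scope.

(** The preceding section is applied to [S = R / c] with its finite injective resolution. Linkage is
    symmetric, so [x] is regular on both quotients. *)
Lemma linked_regular (R : comNzRingType) (m : R -> Prop) (a b : idealr R) :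
  noetherian R -> ideal m -> ~ m 1 ->
  (forall x, ~ m x -> exists u, u * x = 1) ->
  linked a b -> has_krull_dim {ideal_quot a} 2 ->
  exists x y, [/\ m x, m y,
    regular_mod (fun r => r \in a) x, regular_mod (fun r => r \in b) x
    & forall u v, m u -> m v -> regular_mod (fun r => r \in b) u ->
        regular_mod (adjoin (fun r => r \in b) u) v ->
        regular_mod (adjoin (fun r => r \in a) x) y].
Proof.
move=> noethR hm m1 unit_out [c [gor_c aE bE]] [chain2 chain_le2].
have [_ _ [n [E [e [d [E_inj e_inj exact0 exactS E_zero]]]]]] := gor_c.
have aE' r : r \in a <-> forall y, y \in b -> ker (quot_proj c) (r * y).
  by rewrite ker_quot_proj; exact: aE.
have bE' r : r \in b <-> forall y, y \in a -> ker (quot_proj c) (r * y).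
  by rewrite ker_quot_proj; exact: bE.
have a1 : ~ 1 \in a by rewrite idealr1.
have chain2' : prime_chain_over (fun r => r \in a) 2.
  by rewrite -ker_quot_proj; apply/prime_chain_ker; [exact: quot_proj_surj | exact: chain2].
have chain3 : ~ prime_chain_over (fun r => r \in a) 3.
  rewrite -ker_quot_proj => /(prime_chain_ker (@quot_proj_surj _ _)) /chain_le2.
  by [].
have [x [y [mx my reg_x h]]] := linked_depth (@quot_proj_surj _ c) E_inj e_inj
  exact0 exactS noethR hm m1 unit_out E_zero (ideal_idealr b) a1 aE' bE' chain2' chain3.
exists x, y; split=> //.
- exact: regular_colon aE' _ reg_x.
- exact: regular_colon bE' _ reg_x.
Qed.

End LinkedQuotients.

Theorem corollary3p7 (R : comNzRingType) (a b : idealr R) :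
  gorenstein_local R ->
  linked a b ->
  has_krull_dim {ideal_quot a} 2 ->
  ~ cohen_macaulay {ideal_quot a} ->
  has_depth {ideal_quot b} 1 /\ has_depth {ideal_quot a} 1.
Proof.
move=> [noethR [mR loc_m] _] link dim2 notCM.
pose m r := r \in mR.
have hm : ideal m by exact: ideal_idealr.
have m1 : ~ m (GRing.one R) by rewrite /m idealr1.
have unit_out := local_unit_out noethR loc_m.
have [x [y [mx my reg_ax reg_bx regular_a]]] :=
  linked_regular noethR hm m1 unit_out link dim2.
have depthI (I : idealr R) := has_depth_quotient (@quot_proj_surj _ I) hm m1 unit_out.
(* A regular pair on [R / a] would make its depth equal to its dimension 2. *)
have not_regular_a u v : m u -> m v -> regular_mod (fun r => r \in a) u ->
    ~ regular_mod (adjoin (fun r => r \in a) u) v.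
  move=> mu mv reg_u reg_v; apply: notCM; split.
    exact: noetherian_quotient (@quot_proj_surj _ a) noethR.
  exists 2; split=> //; apply: depthI; rewrite ker_quot_proj.
    exists [:: u; v]; split=> // z.
    by rewrite !inE => /orP [] /eqP ->.
  move=> s sm reg_s; apply: dim2.2.
  apply/(prime_chain_ker (@quot_proj_surj _ a)); rewrite ker_quot_proj.
  apply: (regular_prime_chain noethR hm m1 unit_out) => //.
    exact: ideal_idealr.
  by rewrite -ker_quot_proj; exact: ker_sub_maximal.
have depth1 (I : idealr R) : regular_mod (fun r => r \in I) x ->
    (forall u v, m u -> m v -> regular_mod (fun r => r \in I) u ->
      ~ regular_mod (adjoin (fun r => r \in I) u) v) ->
    has_depth {ideal_quot I} 1.
  move=> reg_x no2; apply: depthI; rewrite ker_quot_proj.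
    by exists [:: x]; split=> // z; rewrite inE => /eqP ->.
  move=> [|u [|v s]] // sm [reg_u [reg_v _]].
  by case: (no2 u v) => //; apply: sm; rewrite !inE eqxx ?orbT.
(* Only [R / b] remains: a regular pair on it would make [x, y] regular on [R / a]. *)
split; apply: depth1 => // u v mu mv reg_u reg_v.
by apply: (not_regular_a x y) => //; exact: (regular_a u v).
Qed.
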